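(* Let $X,Y$ be real Banach spaces such that $X$ and $Y^*$ are reflexive, smooth and 2-convex, let $T:X\to Y$ be linear and continuous, let $f\in\Gamma(X)$, $g\in\Gamma(Y)$ be nonnegative, and let $(\bar x,-\bar p)\in X\times Y^*$ be a solution of the saddle-point problem $$\min_{x\in X}\max_{p\in Y^*}\; -\langle Tx,p\rangle_Y+f(x)-g^*(-p).$$ Let $C_X,C_{Y^*}>0$ be constants with $\mathcal{B}_X(x,u)\ge \frac{C_X}{2}\|x-u\|_X^2$ for all $x,u\in X$ and $\mathcal{B}_{Y^*}(y^*,p)\ge\frac{C_{Y^*}}{2}\|y^*-p\|_{Y^*}^2$ for all $y^*,p\in Y^*$. Assume there are $\gamma,\delta>0$ such that $$f(u)-f(x)\ge\langle u-x,x^*\rangle_X+\gamma\,\mathcal{B}_X(u,x)\qquad\text{for all }x,u\in X,\ x^*\in\partial f(x),$$ $$g^*(p)-g^*(y^* )\ge\langle y,p-y^*\rangle_Y+\delta\,\mathcal{B}_{Y^*}(p,y^* )\qquad\text{for all }y^*,p\in Y^*,\ y\in\partial g^*(y^* ).$$ Let $\mu>0$ satisfy $\mu\le\frac{\sqrt{\gamma\delta}\,\min\{C_X,C_{Y^*}\}}{\|T\|}$ (no upper restriction if $T=0$), set $\sigma=\frac{\mu}{\delta}$, $\tau=\frac{\mu}{\gamma}$, and let $\theta\in\big[\frac1{1+\mu},1\big]$. Let $(x_0,p_0)\in X\times Y^*$, $\hat x_0:=x_0$, and let $(x_k,p_k)_{k\in\mathbb{N}}$ be generated by $$p_{k+1}=(\sigma\,\partial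 g^*+J_{Y^*})^{-1}\big(J_{Y^*}(p_k)+\sigma T\hat x_k\big),\quad x_{k+1}=(\tau\,\partial f+J_X)^{-1}\big(J_X(x_k)-\tau T^*p_{k+1}\big),\quad \hat x_{k+1}=x_{k+1}+\theta(x_{k+1}-x_k).$$ Then, with $\omega:=\frac{1+\theta}{2+\mu}<1$, for all $N\in\mathbb{N}$ $$(1-\omega)\,\delta\,\mathcal{B}_{Y^*}(\bar p,p_N)+\gamma\,\mathcal{B}_X(\bar x,x_N)\le\omega^N\big(\delta\,\mathcal{B}_{Y^*}(\bar p,p_0)+\gamma\,\mathcal{B}_X(\bar x,x_0)\big).$$
   Context: For a Banach space $Z$ with dual $Z^*$ write $\langle z,z^*\rangle_Z=z^*(z)$. $\Gamma(Z)$ is the set of proper, convex, lower semicontinuous functions $Z\to(-\infty,+\infty]$; $h^*$ denotes the Fenchel conjugate and $\partial h(z)=\{z^*\in Z^*: \langle u-z,z^*\rangle_Z\le h(u)-h(z)\ \forall u\in Z\}$ the subdifferential (by reflexivity $\partial g^*(y^* )\subset Y^{**}=Y$). $Z$ is 2-convex if there is $C>0$ such that $\delta_Z(\epsilon):=\inf\{1-\|\tfrac12(x+u)\|_Z:\|x\|_Z=\|u\|_Z=1,\ \|x-u\|_Z\ge\epsilon\}\ge C\epsilon^2$ for all $\epsilon\in[0,2]$. $J_Z=\partial\big(\tfrac12\|\cdot\|_Z^2\big)$ is the normalized duality mapping; $J_X:X\to X^*$ and $J_{Y^*}:Y^*\to Y^{**}=Y$ are single-valued bijections in the present setting, with inverses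 $J_{X^*}$ and $J_Y$. For $h\in\Gamma(Z)$, $Z$ reflexive, and $\tau>0$, the generalized resolvent $(\tau\,\partial h+J_Z)^{-1}:Z^*\to Z$ is well-defined and single-valued: it maps $u$ to the unique $z$ with $u\in\tau\,\partial h(z)+J_Z(z)$ (for $h=g^*$ on $Y^*$ it maps $Y\to Y^*$). The Bregman distance is $\mathcal{B}_Z(u,x):=\tfrac12\|u\|_Z^2-\tfrac12\|x\|_Z^2-\langle u-x,J_Z(x)\rangle_Z$. Since $X$ and $Y^*$ are reflexive, smooth and 2-convex, constants $C_X,C_{Y^*}$ as in the claim exist. A pair $(\bar x,-\bar p)\in X\times Y^*$ solves the saddle-point problem iff $-T^*\bar p\in\partial f(\bar x)$ and $T\bar x\in\partial g^*(\bar p)$. *)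

(* Defs.v *)
From HB Require Import structures.
From mathcomp Require Import all_boot all_order all_algebra.
From mathcomp Require Import all_classical all_reals ereal interval_inference.
From mathcomp Require Import topology normedtype.
From mathcomp Require Import lra.

Set Implicit Arguments.
Unset Strict Implicit.
Unset Printing Implicit Defensive.

Import Order.TTheory GRing.Theory Num.Theory.
Import numFieldNormedType.Exports.

Local Open Scope classical_set_scope.
Local Open Scope ring_scope.

Section Clin.
Context {R : realType} {X Y : normedModType R}.

Definition is_clin : {pred X -> Y} := fun f => `[< linear f /\ continuous f >].

Record clin := Clin { clin_fun :> X -> Y; clin_funP : clin_fun \in is_clin }.

HB.instance Definition _ := [isSub for clin_fun].
HB.instance Definition _ := [Choice of clin by <:].

Lemma is_clin_submod_closed : submod_closed is_clin.
Proof.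
split.
  apply/asboolP; split=> [a u v|x]; last exact: cst_continuous.
  by rewrite -[0]/(cst 0) /= scaler0 addr0.
move=> a f g /asboolP[lf cf] /asboolP[lg cg]; apply/asboolP; split=> [b u v|x].
  rewrite !fctE lf lg !scalerDr !scalerA [b * a]mulrC -!addrA; congr (_ + _).
  by rewrite addrCA.
change ((fun z => a *: f z + g z) @ x --> a *: f x + g x).
by apply: cvgD; [apply: cvgZl_tmp; exact: cf|exact: cg].
Qed.

HB.instance Definition _ :=
  GRing.isSubmodClosed.Build _ _ is_clin is_clin_submod_closed.
HB.instance Definition _ := [SubChoice_isSubLmodule of clin by <:].

Lemma clin_linear (f : clin) : linear f.
Proof. by have /asboolP[] := clin_funP f. Qed.

Lemma clin_continuous (f : clin) : continuous f.
Proof. by have /asboolP[] := clin_funP f. Qed.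

HB.instance Definition _ (f : clin) :=
  GRing.isLinear.Build R X Y *:%R (clin_fun f) (clin_linear f).

Definition opnorm (f : clin) : R := sup [set `|f x| | x in [set x | `|x| <= 1]].

Lemma clinD (f g : clin) x : (f + g) x = f x + g x.
Proof. by []. Qed.

Lemma clinZ a (f : clin) x : (a *: f) x = a *: f x.
Proof. by []. Qed.

Lemma clinN (f : clin) x : (- f) x = - f x.
Proof. by []. Qed.

Lemma clin0 x : (0 : clin) x = 0.
Proof. by []. Qed.

Lemma clinP (f g : clin) : f =1 g -> f = g.
Proof. by move=> fg; apply: val_inj; apply/funext. Qed.

Lemma opnorm_has_sup (f : clin) :
  has_sup [set `|f x| | x in [set x | `|x| <= 1]].
Proof.
split; first by exists `|f 0|, 0 => //=; rewrite normr0.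
have /bounded_funP/(_ 1)[M fM] := continuous_linear_bounded 0
  (@clin_continuous f 0).
by exists M => _ [x /= x1 <-]; exact: fM.
Qed.

Lemma opnormP (f : clin) x : `|f x| <= opnorm f * `|x|.
Proof.
have [->|x0] := eqVneq x 0; first by rewrite linear0 !normr0 mulr0.
have nx0 : 0 < `|x| by rewrite normr_gt0.
rewrite -ler_pdivrMr //.
apply: ub_le_sup; first by have [] := opnorm_has_sup f.
exists (`|x|^-1 *: x) => /=.
  by rewrite normrZ ger0_norm ?invr_ge0 // mulVf ?gt_eqF.
by rewrite linearZ normrZ ger0_norm ?invr_ge0 // mulrC.
Qed.

Lemma opnorm_le (f : clin) M : 0 <= M ->
  (forall x, `|f x| <= M * `|x|) -> opnorm f <= M.
Proof.
move=> M0 fM; apply: ge_sup; first by have [] := opnorm_has_sup f.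
move=> _ [x /= x1 <-]; apply: le_trans (fM x) _.
by rewrite -[leRHS]mulr1 ler_wpM2l.
Qed.

Lemma opnorm_ge0 (f : clin) : 0 <= opnorm f.
Proof.
apply: ub_le_sup; first by have [] := opnorm_has_sup f.
by exists 0; rewrite /= ?normr0 // linear0 normr0.
Qed.

Lemma ler_opnormD f g : opnorm (f + g) <= opnorm f + opnorm g.
Proof.
apply: opnorm_le => [|x]; first by rewrite addr_ge0 ?opnorm_ge0.
rewrite clinD mulrDl (le_trans (ler_normD _ _)) //.
by apply: lerD; exact: opnormP.
Qed.

Lemma opnormZ_le a f : opnorm (a *: f) <= `|a| * opnorm f.
Proof.
apply: opnorm_le => [|x]; first by rewrite mulr_ge0 ?opnorm_ge0.
by rewrite clinZ normrZ -mulrA ler_wpM2l // opnormP.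
Qed.

Lemma opnormZ a f : opnorm (a *: f) = `|a| * opnorm f.
Proof.
apply/eqP; rewrite eq_le opnormZ_le /=.
have [->|a0] := eqVneq a 0; first by rewrite normr0 mul0r opnorm_ge0.
rewrite -ler_pdivlMl ?normr_gt0 // -normfV.
by rewrite (le_trans _ (opnormZ_le _ _)) // scalerA mulVf // scale1r.
Qed.

Lemma opnorm_eq0 f : opnorm f = 0 -> f = 0.
Proof.
move=> f0; apply: clinP => x; apply/eqP; rewrite clin0 -normr_le0.
by rewrite (le_trans (opnormP _ _)) // f0 mul0r.
Qed.

HB.instance Definition _ :=
  Lmodule_isNormed.Build R clin ler_opnormD opnormZ opnorm_eq0.

Lemma clin_normE (f : clin) : `|f| = opnorm f.
Proof. by []. Qed.

End Clin.
Arguments clin {R} X Y.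

Notation dual Z := (clin Z (GRing.regular _)).

Section Dual.
Context {R : realType}.
Implicit Types X Y Z : normedModType R.

Definition pairing Z (z : Z) (zs : dual Z) : R := zs z.

Lemma pairing0 Z (z : Z) : pairing z 0 = 0.
Proof. by []. Qed.

Lemma pairingN Z (z : Z) (zs : dual Z) : pairing z (- zs) = - pairing z zs.
Proof. by []. Qed.

Lemma pairingBr Z (z : Z) (zs ws : dual Z) :
  pairing z (zs - ws) = pairing z zs - pairing z ws.
Proof. by []. Qed.

Lemma pairingBl Z (z w : Z) (zs : dual Z) :
  pairing (z - w) zs = pairing z zs - pairing w zs.
Proof. exact: linearB. Qed.

Fact adjoint_subproof X Y (T : clin X Y) (p : dual Y) :
  ((fun x => p (T x)) : X -> R^o) \in is_clin.
Proof.
apply/asboolP; split=> [a u v|x]; first by rewrite !linearP.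
by apply: (continuous_comp (@clin_continuous _ _ _ T x)); exact: clin_continuous.
Qed.

Definition adjoint X Y (T : clin X Y) (p : dual Y) : dual X :=
  Clin (adjoint_subproof T p).

Fact bidual_subproof Z (z : Z) :
  ((fun zs : dual Z => pairing z zs) : dual Z -> R^o) \in is_clin.
Proof.
have lin : linear ((fun zs : dual Z => pairing z zs) : dual Z -> R^o) by [].
pose L : {linear dual Z -> R^o} := HB.pack
  ((fun zs : dual Z => pairing z zs) : dual Z -> R^o)
  (GRing.isLinear.Build R (dual Z) R^o *:%R _ lin).
apply/asboolP; split=> //; apply: (@bounded_linear_continuous _ _ _ L).
apply/bounded_funP => r; exists (r * `|z|) => zs zsr.
by rewrite (le_trans (opnormP zs z)) // ler_wpM2r.
Qed.

Definition bidual_emb Z (z : Z) : dual (dual Z) := Clin (bidual_subproof z).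

Lemma pairing_adjoint X Y (T : clin X Y) (x : X) (p : dual Y) :
  pairing x (adjoint T p) = pairing (T x) p.
Proof. by []. Qed.

Lemma pairing_bidual Z (z : Z) (zs : dual Z) :
  pairing zs (bidual_emb z) = pairing z zs.
Proof. by []. Qed.

End Dual.

Section Geometry.
Context {R : realType}.
Variable Z : normedModType R.

Definition reflexive_space : Prop :=
  forall F : dual (dual Z), exists z : Z, F = bidual_emb z.

Definition smooth_space : Prop :=
  forall z : Z, z != 0 ->
    exists! zs : dual Z, `|zs| = 1 /\ pairing z zs = `|z|.

(* An extended real, so that the infimum over the empty set is +oo. *)
Definition convexity_modulus (e : R) : \bar R :=
  ereal_inf [set (1 - `|2^-1 *: (xu.1 + xu.2)|)%:E | xu in
    [set xu : Z * Z | [/\ `|xu.1| = 1, `|xu.2| = 1 & e <= `|xu.1 - xu.2|]]].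

Definition two_convex : Prop :=
  exists2 C : R, 0 < C & forall e, 0 <= e <= 2 ->
    ((C * e ^+ 2)%:E <= convexity_modulus e)%E.

End Geometry.

Section Convex.
Context {R : realType} {Z : normedModType R}.
Implicit Types (h : Z -> \bar R) (z u : Z) (zs : dual Z) (tau : R).
Local Open Scope ereal_scope.

Definition proper_fun h : Prop :=
  (forall z, -oo < h z) /\ exists z, h z < +oo.

Definition convex_efun h : Prop :=
  forall z u (t : R), (0 <= t <= 1)%R ->
    h (t *: z + (1 - t) *: u)%R <= t%:E * h z + (1 - t)%:E * h u.

Definition Gamma : set (Z -> \bar R) :=
  [set h | [/\ proper_fun h, convex_efun h & lower_semicontinuous h]].

Definition fenchel h (zs : dual Z) : \bar R :=
  ereal_sup [set (pairing z zs)%:E - h z | z in [set: Z]].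

(* When [h z = +oo], every [h u - h z] is [-oo], so the set is empty. *)
Definition subdiff h z : set (dual Z) :=
  [set zs | forall u, (pairing (u - z)%R zs)%:E <= h u - h z].

Definition half_sqnorm z : \bar R := (2^-1 * `|z| ^+ 2)%:E.

(* Meaningful when [subdiff half_sqnorm z] is a singleton, as it is in smooth
   spaces. *)
Definition J z : dual Z := xget 0%R (subdiff half_sqnorm z).

(* The value of the inverse of [tau * subdiff h + J] at [v], as a set: it is
   a singleton when the generalized resolvent is well defined. *)
Definition resolvent tau h (v : dual Z) : set Z :=
  [set z | exists2 zs, subdiff h z zs & v = (tau *: zs + J z)%R].

Definition bregman u z : R :=
  (2^-1 * `|u| ^+ 2 - 2^-1 * `|z| ^+ 2 - pairing (u - z) (J z))%R.

End Convex.

Section Saddle.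
Context {R : realType} {X Y : normedModType R}.
Variables (T : clin X Y) (f : X -> \bar R) (g : Y -> \bar R).
Local Open Scope ereal_scope.

(* [+oo - +oo] evaluates to [-oo] here; with this convention the saddle points
   are exactly the pairs satisfying the extremal relations (saddle_pointP). *)
Definition lagrangian (x : X) (p : dual Y) : \bar R :=
  (- pairing (T x) p)%:E + f x - fenchel g (- p)%R.

Definition saddle_point (x : X) (p : dual Y) : Prop :=
  forall x' p', lagrangian x p' <= lagrangian x p <= lagrangian x' p.

Lemma fenchel_ge p y : (pairing y p)%:E - g y <= fenchel g p.
Proof. by apply: ereal_sup_ubound; exists y. Qed.

Lemma saddle_pointP (xbar : X) (pbar : dual Y) :
  proper_fun f -> proper_fun g -> (forall x, 0 <= f x) -> (forall y, 0 <= g y) ->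
  saddle_point xbar (- pbar)%R <->
  subdiff f xbar (- adjoint T pbar)%R /\
  subdiff (fenchel g) pbar (bidual_emb (T xbar)).
Proof.
move=> [_ [x1 fx1]] [_ [y1 gy1]] f0 g0.
have gs0 : fenchel g 0%R <= 0.
  by apply: ge_ereal_sup => _ [y _ <-]; rewrite pairing0 sub0e oppe_le0.
have gsN p : -oo < fenchel g p.
  apply: lt_le_trans (fenchel_ge p y1).
  by case: (g y1) (g0 y1) gy1 => //= r _ _; rewrite -EFinB ltNyr.
have LE x p : lagrangian x (- p)%R =
    (pairing (T x) p)%:E + f x - fenchel g p.
  by rewrite /lagrangian pairingN !opprK.
have efin (a : \bar R) : 0 <= a -> a < +oo -> exists r, a = r%:E.
  by case: a => // r _ _; exists r.
have gfinE p : fenchel g p < +oo -> exists r, fenchel g p = r%:E.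
  by have := gsN p; case: (fenchel g p) => // r _ _; exists r.
have [G0 gG0] : exists r, fenchel g 0%R = r%:E.
  by apply: gfinE; exact: le_lt_trans gs0 (ltry 0).
split=> [sp|[sf sg]].
- have sp1 x (p : dual Y) : lagrangian xbar (- p)%R <= lagrangian xbar (- pbar)%R
      <= lagrangian x (- pbar)%R by exact: sp.
  have gfin : fenchel g pbar < +oo.
    rewrite ltNge leye_eq; apply/negP => /eqP goo.
    have /andP[+ _] := sp1 xbar 0%R; rewrite !LE goo gG0 /= addeNy leeNy_eq.
    by have := f0 xbar; case: (f xbar).
  have ffin : f xbar < +oo.
    have /andP[_] := sp1 x1 0%R; rewrite !LE.
    have [G ->] := gfinE _ gfin; have [F1 ->] := efin _ (f0 x1) fx1.
    by case: (f xbar) (f0 xbar) => // r _; rewrite ltry.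
  have [G gG] := gfinE _ gfin; have [F fF] := efin _ (f0 xbar) ffin.
  split=> [u|p].
    have /andP[_] := sp1 u 0%R; rewrite !LE gG fF.
    case: (f u) (f0 u) => [r _|_|//]; last by rewrite addye ?leey.
    rewrite -!EFinD !lee_fin pairingN !pairing_adjoint linearB pairingBl => ?; lra.
  have /andP[+ _] := sp1 xbar p; rewrite !LE gG fF.
  case: (fenchel g p) (gsN p) => [r _|_ _|//]; last by rewrite addye ?leey.
  rewrite -!EFinD !lee_fin pairing_bidual pairingBr => ?; lra.
- have ffin : f xbar < +oo.
    rewrite ltNge leye_eq; apply/negP => /eqP foo.
    by have := sf x1; rewrite foo addeNy leeNy_eq.
  have gfin : fenchel g pbar < +oo.
    rewrite ltNge leye_eq; apply/negP => /eqP goo.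
    by have := sg 0%R; rewrite goo addeNy leeNy_eq.
  have [G gG] := gfinE _ gfin; have [F fF] := efin _ (f0 xbar) ffin.
  move=> x p; rewrite -[p]opprK; move: (- p)%R => {}p; rewrite !LE gG fF.
  apply/andP; split.
    have := sg p; rewrite gG.
    case: (fenchel g p) (gsN p) => [r _|_ _|//]; last by rewrite addeNy leNye.
    rewrite -!EFinD !lee_fin pairing_bidual pairingBr => ?; lra.
  have := sf x; rewrite fF.
  case: (f x) (f0 x) => [r _|_ _|//]; last by rewrite addey ?leey.
  rewrite -!EFinD !lee_fin pairingN pairing_adjoint linearB pairingBl => ?; lra.
Qed.

End Saddle.

(* Main.v *)
Require Import Defs.
From HB Require Import structures.
From mathcomp Require Import all_boot all_order all_algebra.
From mathcomp Require Import all_classical all_reals ereal.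
From mathcomp Require Import topology normedtype sequences.
From mathcomp Require Import ring lra.

(** In each half-step the optimality inclusion is added to the one that holds at
    the saddle point. Strong convexity relative to the Bregman distance B,
    together with the three-point identity of B, gives (resolvent_step)
      (1 + mu) (gamma B(xbar, x_{k+1})) + gamma B(x_{k+1}, x_k)
        + mu <T (x_{k+1} - xbar), p_{k+1} - pbar> <= gamma B(xbar, x_k)
    and a similar estimate for p. In their sum the cross terms collapse to
    mu <T (x_{k+1} - xhat_k), p_{k+1} - pbar>. With
      A_k = gamma B(xbar, x_k),        D_k = delta B(pbar, p_k),
      a_k = gamma B(x_k, x_{k-1}),
      c_k = mu <T (x_k - x_{k-1}), p_k - pbar>
    the extrapolation turns this into c_{k+1} - omega c_k plus two remainders.
    Cauchy-Schwarz and Young's inequality with a free weight s bound them by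
    Bregman distances (coupling_bregman); this is where the bound on mu enters.
    With s = omega the value omega = (1 + theta) / (2 + mu) balances all terms,
    and
      V_k = A_k + D_k + omega (a_k + c_k)
    satisfies V_{k+1} <= omega V_k (lyapunov_step). Putting x_{-1} = x_0 makes
    V_0 = A_0 + D_0. Finally c_k >= - a_k - D_k, the same bound with s = 1,
    gives V_N >= A_N + (1 - omega) D_N, which is the claim.

    The resolvent for the conjugate of g produces a subgradient in the bidual
    of Y, while strong convexity of the conjugate speaks of subgradients in Y.
    So Y has to be reflexive, and this must be deduced from reflexivity of its
    dual (reflexive_predual): if the canonical image of Y, which is closed, were
    a proper subspace of the bidual, Hahn-Banach would give a nonzero functional
    vanishing on it; that functional is evaluation at some element of the dual
    of Y, and this element vanishes on all of Y. The Hahn-Banach theorem used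
    here is the statement that a minimal sublinear functional is linear
    (hahn_banach). *)

Import Order.TTheory GRing.Theory Num.Theory.
Import numFieldNormedType.Exports.

Local Open Scope classical_set_scope.
Local Open Scope ring_scope.

(** * The Hahn-Banach theorem *)

Section HahnBanach.
Context {R : realType} {E : lmodType R}.
Implicit Types (p q : E -> R) (x y : E).

(** Positive homogeneity is required as an inequality because this form passes
    to infima at once; equality is recovered in sublinearZ. *)
Definition sublinear q :=
  (forall x y, q (x + y) <= q x + q y) /\
  (forall a x, 0 < a -> q (a *: x) <= a * q x).

Lemma sublinear0 q : sublinear q -> q 0 = 0.
Proof.
move=> [qD qZ]; have := qD 0 0; have /(qZ _ 0) : (0 : R) < 2^-1 by lra.
by rewrite scaler0 addr0 => ? ?; lra.
Qed.

Lemma sublinearZ q a x : sublinear q -> 0 <= a -> q (a *: x) = a * q x.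
Proof.
move=> qS; rewrite le_eqVlt => /predU1P[<-|a0].
  by rewrite scale0r mul0r sublinear0.
apply/eqP; rewrite eq_le; case: (qS) => _ qZ; rewrite qZ //=.
rewrite -ler_pdivlMl // -[x in q x <= _](scalerK (lt0r_neq0 a0)).
by rewrite qZ // invr_gt0.
Qed.

Lemma sublinear_ge q x y : sublinear q -> q x - q (- y) <= q (x + y).
Proof.
by move=> [qD _]; rewrite lerBlDr -{1}[x](addrK y) qD.
Qed.

Lemma sublinear_geN q x : sublinear q -> - q (- x) <= q x.
Proof.
by move=> qS; have := sublinear_ge q 0 x qS; rewrite (sublinear0 q qS) sub0r add0r.
Qed.

(** The largest sublinear functional below q whose value at - y is at most
    - q y. A minimal q equals its tilts, and this forces q to be additive. *)
Definition tilt q y x : R :=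
  inf [set q (x + t *: y) - t * q y | t in [set t | 0 <= t]].

Lemma tilt_le q y x t : sublinear q -> 0 <= t ->
  tilt q y x <= q (x + t *: y) - t * q y.
Proof.
move=> qS t0; apply: ge_inf; last by exists t.
exists (- q (- x)) => _ [s /= s0 <-].
rewrite -sublinearZ //; have := sublinear_ge q (s *: y) x qS.
by rewrite [s *: y + x]addrC; lra.
Qed.

Lemma tilt_ge q y x m :
  (forall t, 0 <= t -> m <= q (x + t *: y) - t * q y) -> m <= tilt q y x.
Proof.
move=> mP; apply: lb_le_inf; first by exists (q (x + 0 *: y) - 0 * q y), 0 => /=.
by move=> _ [t /= t0 <-]; exact: mP.
Qed.

Lemma tilt_sublinear q y : sublinear q -> sublinear (tilt q y).
Proof.
move=> qS; split=> [x1 x2|a x a0].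
- rewrite -lerBlDr; apply: tilt_ge => s s0; rewrite lerBlDl -lerBlDr.
  apply: tilt_ge => t t0; have st0 := addr_ge0 s0 t0.
  have := tilt_le q y (x1 + x2) _ qS st0; rewrite scalerDl addrACA.
  by case: qS => qD _; have := qD (x1 + s *: y) (x2 + t *: y); lra.
- rewrite -ler_pdivrMl //; apply: tilt_ge => t t0; rewrite ler_pdivrMl //.
  have /(tilt_le q y (a *: x) _ qS) := mulr_ge0 (ltW a0) t0.
  by rewrite -scalerA -scalerDr (sublinearZ _ _ _ qS (ltW a0)) mulrBr mulrA.
Qed.

(** Zorn's lemma applies because the pointwise infimum of a chain of sublinear
    functionals is sublinear: two values, taken at x and at y by two members of
    the chain, are both bounded below by those of the smaller member. All
    members lie above - p (- x), so the infimum is finite. *)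
Lemma minimal_sublinear p : sublinear p ->
  exists q, [/\ sublinear q, forall x, q x <= p x &
    forall r, sublinear r -> (forall x, r x <= q x) -> forall x, q x <= r x].
Proof.
move=> pS; pose below := {q | sublinear q /\ forall x, q x <= p x}.
pose top : below := exist _ p (conj pS (fun x => lexx _)).
pose ord : rel below := fun b c => `[< forall x, sval c x <= sval b x >].
have [||A Atot|[q [qS qp]] qmin] := @ZL_preorder below top ord.
- by move=> b; apply/asboolP.
- move=> b c d /asboolP bc /asboolP cd; apply/asboolP => x.
  exact: le_trans (cd x) (bc x).
- have [[b0 Ab0]|A0] := pselect (A !=set0); last first.
    by exists top => b Ab; case: A0; exists b.
  pose r x := inf [set sval b x | b in A].
  have r_le b x : A b -> r x <= sval b x.
    move=> Ab; apply: ge_inf; last by exists b.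
    exists (- p (- x)) => _ [[s [sS sp]] _ <-] /=.
    by apply: le_trans (sublinear_geN s x sS); rewrite lerN2.
  have r_ge m x : (forall b, A b -> m <= sval b x) -> m <= r x.
    move=> mP; apply: lb_le_inf; first by exists (sval b0 x), b0.
    by move=> _ [b Ab <-]; exact: mP.
  have rS : sublinear r.
    split=> [x y|a x a0].
      rewrite -lerBlDr; apply: (r_ge) => b1 Ab1; rewrite lerBlDl -lerBlDr.
      apply: (r_ge) => b2 Ab2; rewrite lerBlDr.
      have [b Ab [bb1 bb2]] : exists2 b, A b &
          (forall x, sval b x <= sval b1 x) /\ (forall x, sval b x <= sval b2 x).
        by case: (Atot _ _ Ab1 Ab2) => /asboolP le; [exists b2|exists b1].
      apply: le_trans (r_le _ _ Ab) _; have [[bD _] _] := svalP b.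
      by apply: le_trans (bD x y) _; rewrite addrC lerD.
    rewrite -ler_pdivrMl //; apply: (r_ge) => b Ab; rewrite ler_pdivrMl //.
    apply: le_trans (r_le _ _ Ab) _; have [[_ bZ] _] := svalP b.
    exact: bZ.
  have rp x : r x <= p x.
    by apply: le_trans (r_le _ x Ab0) _; have [_] := svalP b0; apply.
  exists (exist _ r (conj rS rp)) => b Ab; apply/asboolP => x /=.
  exact: r_le.
exists q; split=> // r rS rq.
have rp x : r x <= p x by exact: le_trans (rq x) (qp x).
by have /asboolP := qmin (exist _ r (conj rS rp)) (asboolT rq).
Qed.

(** A minimal sublinear q is linear: q = tilt q y gives q x <= q (x + y) - q y,
    hence additivity. Starting the minimization at tilt p e instead of p is what
    secures the value at e, since tilt p e (- e) <= - p e. *)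
Theorem hahn_banach p e : sublinear p ->
  exists2 phi : E -> R, linear (phi : E -> R^o) &
    (forall x, phi x <= p x) /\ phi e = p e.
Proof.
move=> pS; have [q [qS qp qmin]] := minimal_sublinear _ (tilt_sublinear _ e pS).
have tilt_p x : tilt p e x <= p x.
  by have := tilt_le p e x _ pS (lexx 0); rewrite scale0r addr0 mul0r subr0.
have qD x y : q (x + y) = q x + q y.
  apply/eqP; rewrite eq_le; have [-> _] := qS; rewrite /=.
  have qt : q x <= tilt q y x.
    apply: qmin; first exact: tilt_sublinear.
    move=> z; have := tilt_le q y z _ qS (lexx 0).
    by rewrite scale0r addr0 mul0r subr0.
  have := le_trans qt (tilt_le q y x _ qS ler01).
  by rewrite scale1r mul1r lerBrDr.
have qN x : q (- x) = - q x.
  by apply/eqP; rewrite -addr_eq0 -qD addNr (sublinear0 q qS).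
have qZ a x : q (a *: x) = a * q x.
  have [a0|a0] := leP 0 a; first exact: sublinearZ.
  rewrite -[a *: x]opprK -scaleNr qN sublinearZ ?oppr_ge0 ?ltW //.
  by rewrite mulNr opprK.
exists q; first by move=> a x y; rewrite qD qZ.
split=> [x|]; first exact: le_trans (qp x) (tilt_p x).
apply/eqP; rewrite eq_le (le_trans (qp e) (tilt_p e)) /=.
have := le_trans (qp (- e)) (tilt_le p e (- e) _ pS ler01).
by rewrite scale1r addNr (sublinear0 p pS) mul1r sub0r qN lerN2.
Qed.

End HahnBanach.

(** * Reflexivity passes from the dual to the space *)

Section Reflexivity.
Context {R : realType}.

Lemma clin_of_bounded (E : normedModType R) (phi : E -> R^o) :
  linear phi -> (forall x, phi x <= `|x|) ->
  exists2 F : dual E, (forall x, F x = phi x) & `|F| <= 1.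
Proof.
move=> lin phi_le.
pose L : {linear E -> R^o} := HB.pack phi
  (GRing.isLinear.Build R E R^o *:%R _ lin).
have L1 x : `|phi x| <= 1 * `|x|.
  rewrite mul1r ler_norml phi_le andbT -[in leRHS](opprK x).
  by rewrite -normrN opprK lerNl -[phi x]/(L x) -linearN phi_le.
have phi_clin : phi \in is_clin.
  apply/asboolP; split=> //; apply: (@bounded_linear_continuous _ _ _ L).
  apply/bounded_funP => r; exists r => x xr.
  by apply: le_trans (L1 x) _; rewrite mul1r.
by exists (Clin phi_clin) => //; exact: opnorm_le.
Qed.

Lemma hahn_banach_dual (E : normedModType R) (p : E -> R) e :
  sublinear p -> (forall x, p x <= `|x|) ->
  exists F : dual E, [/\ `|F| <= 1, forall x, F x <= p x & F e = p e].
Proof.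
move=> pS p1; have [phi lin [phi_p phi_e]] := hahn_banach p e pS.
have [|F FE F1] := clin_of_bounded E phi lin.
  by move=> x; exact: le_trans (phi_p x) (p1 x).
by exists F; split=> // [x|]; rewrite FE.
Qed.

Lemma sublinear_norm (E : normedModType R) : sublinear (fun x : E => `|x|).
Proof.
by split=> [x y|a x a0]; [exact: ler_normD|rewrite normrZ gtr0_norm].
Qed.

(** A functional dominated by the norm and equal to it at y shows that evaluation
    at y loses no norm. *)
Lemma norm_bidual_emb (Y : normedModType R) (y : Y) : `|bidual_emb y| = `|y|.
Proof.
apply/eqP; rewrite eq_le; apply/andP; split.
  by apply: opnorm_le => // ys; rewrite mulrC; exact: (opnormP ys y).
have [F [F1 _ Fy]] := hahn_banach_dual Y _ y (sublinear_norm Y) (fun x => lexx _).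
have := opnormP (bidual_emb y) F.
rewrite -[bidual_emb y F]/(F y) Fy normr_id => /le_trans; apply.
by rewrite -[leRHS]mulr1 ler_wpM2l ?opnorm_ge0.
Qed.

Lemma bidual_emb_linear (Y : normedModType R) :
  linear (@bidual_emb R Y : Y -> dual (dual Y)).
Proof.
by move=> a y z; apply: clinP => ys; rewrite clinD clinZ /= /pairing linearP.
Qed.

HB.instance Definition _ (Y : normedModType R) :=
  GRing.isLinear.Build R Y (dual (dual Y)) *:%R _ (bidual_emb_linear Y).

(** The seminorm of the quotient of the bidual by the canonical image of Y;
    functionals dominated by it vanish on that image. *)
Definition emb_dist (Y : normedModType R) (G : dual (dual Y)) : R :=
  inf [set `|G - bidual_emb y| | y in [set: Y]].

Lemma emb_dist_le (Y : normedModType R) (G : dual (dual Y)) y :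
  emb_dist Y G <= `|G - bidual_emb y|.
Proof. by apply: ge_inf; [exists 0 => _ [z _ <-]|exists y]. Qed.

Lemma emb_dist_ge (Y : normedModType R) (G : dual (dual Y)) m :
  (forall y, m <= `|G - bidual_emb y|) -> m <= emb_dist Y G.
Proof.
move=> mP; apply: lb_le_inf; first by exists `|G - bidual_emb 0|, 0.
by move=> _ [y _ <-].
Qed.

Lemma emb_dist_sublinear (Y : normedModType R) : sublinear (emb_dist Y).
Proof.
split=> [G H|a G a0].
  rewrite -lerBlDr; apply: emb_dist_ge => y; rewrite lerBlDl -lerBlDr.
  apply: emb_dist_ge => z; rewrite lerBlDr.
  apply: le_trans (emb_dist_le Y _ (y + z)) _; rewrite linearD opprD addrACA.
  by rewrite [leRHS]addrC; exact: ler_normD.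
rewrite -ler_pdivrMl //; apply: emb_dist_ge => y; rewrite ler_pdivrMl //.
apply: le_trans (emb_dist_le Y _ (a *: y)) _.
by rewrite linearZ -scalerBr normrZ gtr0_norm.
Qed.

(** The canonical image of Y is closed: approximants of G form a Cauchy sequence
    since the embedding is isometric, and Y is complete. *)
Lemma emb_dist0 (Y : completeNormedModType R) (G : dual (dual Y)) :
  emb_dist Y G = 0 -> exists y, G = bidual_emb y.
Proof.
move=> G0.
have near n : exists y, `|G - bidual_emb y| < harmonic n.
  have [_ [y _ <-]] : exists2 r, [set `|G - bidual_emb y| | y in setT] r &
      r < harmonic n.
    apply: inf_lt; first by exists `|G - bidual_emb 0|, 0.
    by rewrite -/(emb_dist Y G) G0 invr_gt0.
  by exists y.
have [u uP] := choice near.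
have small e : 0 < e -> \forall n \near \oo, `|G - bidual_emb (u n)| < e / 2.
  move=> e0; have e20 : 0 < e / 2 by rewrite divr_gt0.
  have := @cvg_harmonic R => /cvgrPdist_lt/(_ _ e20); apply: filterS => n.
  rewrite sub0r normrN ger0_norm ?invr_ge0 //; exact: lt_trans.
have /cvg_ex[l ul] : cvg (u @ \oo).
  apply/cauchy_cvgP/cauchy_exP => e e0; near \oo => n; exists (u n).
  near=> m; rewrite -ball_normE /= -norm_bidual_emb linearB.
  apply: le_lt_trans (ler_distD G _ _) _; rewrite distrC (splitr e).
  by apply: ltrD; [near: n|near: m]; exact: (small).
exists l; apply/eqP; rewrite -subr_eq0 -normr_le0; apply/ler_addgt0Pl => e e0.
near \oo => n; rewrite addr0.
apply: le_trans (ler_distD (bidual_emb (u n)) _ _) _; rewrite (splitr e) ltW //.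
apply: ltrD; first by near: n; exact: (small).
rewrite -linearB norm_bidual_emb distrC; near: n.
by move/cvgrPdist_lt : ul; apply; rewrite divr_gt0.
Unshelve. all: by end_near. Qed.

(** The functional F dominated by the distance to the canonical image and equal
    to it at G is evaluation at some ys, by reflexivity of the dual. As F
    vanishes on the image, ys = 0, so the distance of G to the image is 0. *)
Lemma reflexive_predual (Y : completeNormedModType R) :
  reflexive_space (dual Y) -> reflexive_space Y.
Proof.
move=> reflYs G.
have dist_norm (H : dual (dual Y)) : emb_dist Y H <= `|H|.
  by apply: le_trans (emb_dist_le Y H 0) _; rewrite linear0 subr0.
have dist_emb y : emb_dist Y (bidual_emb y) <= 0.
  by apply: le_trans (emb_dist_le Y _ y) _; rewrite subrr normr0.
have [F [_ F_dist FG]] := hahn_banach_dual _ _ G (emb_dist_sublinear Y) dist_norm.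
have [ys Fys] := reflYs F.
have ys0 : ys = 0.
  have ys_le0 y : ys y <= 0.
    have -> : ys y = F (bidual_emb y) by rewrite Fys.
    exact: le_trans (F_dist _) (dist_emb y).
  apply: clinP => y; rewrite clin0; apply/eqP; rewrite eq_le ys_le0 /=.
  by have := ys_le0 (- y); rewrite linearN oppr_le0.
by apply: emb_dist0; rewrite -FG Fys ys0; exact: (linear0 G).
Qed.

End Reflexivity.

(** * One resolvent step *)

Section ResolventStep.
Context {R : realType} {Z : normedModType R}.
Implicit Types (h : Z -> \bar R) (z u : Z) (zs : dual Z).

Lemma bregman_three_points u a b :
  bregman u a - bregman u b - bregman b a = pairing (u - b) (J b - J a).
Proof.
by rewrite /bregman pairingBr !pairingBl; ring.
Qed.

Lemma subdiff_fin_num h z zs : proper_fun h -> subdiff h z zs ->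
  h z \is a fin_num.
Proof.
move=> [hNy [u hu]] zsP; rewrite fin_numE -ltNye hNy /=.
by apply/eqP => hz; have := zsP u; rewrite hz addeNy leeNy_eq.
Qed.

Lemma proper_fenchel h : (forall z, (0 <= h z)%E) -> proper_fun h ->
  proper_fun (fenchel h).
Proof.
move=> h0 [_ [z hz]]; split=> [zs|].
  apply: lt_le_trans (fenchel_ge h zs z).
  by case: (h z) (h0 z) hz => //= r _ _; rewrite -EFinB ltNyr.
exists 0; apply: le_lt_trans (ltry 0).
by apply: ge_ereal_sup => _ [u _ <-]; rewrite pairing0 sub0e oppe_le0.
Qed.

(** Strong convexity measured by the Bregman distance instead of the square of
    the norm. *)
Definition bregman_convex (kappa : R) h :=
  forall z u zs, subdiff h z zs ->
    ((pairing (u - z) zs + kappa * bregman u z)%:E <= h u - h z)%E.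

Lemma bregman_convex_monotone kappa h z u zs us :
  proper_fun h -> bregman_convex kappa h -> subdiff h z zs -> subdiff h u us ->
  kappa * (bregman u z + bregman z u) <= pairing (u - z) (us - zs).
Proof.
move=> hP hK zsP usP.
have := hK _ z _ usP; have := hK _ u _ zsP.
have := subdiff_fin_num _ _ _ hP zsP; have := subdiff_fin_num _ _ _ hP usP.
case: (h z) => // a _; case: (h u) => // b _.
by rewrite -!EFinB !lee_fin !pairingBr !pairingBl; lra.
Qed.

(** The inclusion defining the resolvent expresses the subgradient at z1 by
    J z0 - J z1 and w, so monotonicity against the subgradient - wbar at zbar
    becomes, by the three-point identity, a decrease of the distance to zbar.
    The scaling by kappa makes the primal and the dual estimates summable. *)
Lemma resolvent_step kappa mu h z0 z1 zbar w wbar :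
  proper_fun h -> bregman_convex kappa h -> 0 < kappa -> 0 < mu ->
  (forall u z, 0 <= bregman u z) ->
  resolvent (mu / kappa) h (J z0 - (mu / kappa) *: w) z1 ->
  subdiff h zbar (- wbar) ->
  (1 + mu) * (kappa * bregman zbar z1) + kappa * bregman z1 z0
    + mu * pairing (z1 - zbar) (w - wbar)
  <= kappa * bregman zbar z0.
Proof.
move=> hP hK kappa0 mu0 B0 [zs zsP J01] zbarP.
have mono := bregman_convex_monotone _ _ _ _ _ _ hP hK zbarP zsP.
have three := bregman_three_points zbar z0 z1.
have kappamu : kappa * (mu / kappa) = mu by rewrite mulrC divfK ?gt_eqF.
have zsE : pairing (z1 - zbar) (J z0 - J z1) =
    mu / kappa * pairing (z1 - zbar) (zs + w).
  transitivity (pairing (z1 - zbar) ((mu / kappa) *: (zs + w))); last by [].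
  have -> : J z0 = (mu / kappa) *: zs + J z1 + (mu / kappa) *: w.
    by rewrite -J01 subrK.
  by rewrite addrAC addrK scalerDr.
have {}zsE : kappa * pairing (z1 - zbar) (J z0 - J z1) =
    mu * pairing (z1 - zbar) (zs + w).
  by rewrite zsE mulrA kappamu.
have drop := mulr_ge0 (ltW mu0) (mulr_ge0 (ltW kappa0) (B0 z1 zbar)).
have {}mono := ler_wpM2l (ltW mu0) mono.
have {}three := congr1 ( *%R kappa) three.
have pairingDr (z : Z) (v v' : dual Z) :
  pairing z (v + v') = pairing z v + pairing z v' by [].
move: mono three zsE drop.
rewrite !(pairingBr, pairingDr, pairingN) !pairingBl.
move: (pairing _ _) => *; lra.
Qed.

End ResolventStep.

(** * Coupling through T, and the rate *)

Lemma coupling_le_norm {R : realType} {X Y : normedModType R}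
  (T : clin X Y) (x : X) (q : dual Y) :
  `|pairing (T x) q| <= opnorm T * `|x| * `|q|.
Proof.
apply: le_trans (opnormP q (T x)) _.
by rewrite [leRHS]mulrC ler_wpM2l ?opnorm_ge0 // opnormP.
Qed.

Lemma weighted_young {R : realType} (s a b : R) : 0 < s ->
  a * b <= 2^-1 * (s * a ^+ 2 + s^-1 * b ^+ 2).
Proof.
move=> s0; have : 0 <= s * (a - s^-1 * b) ^+ 2.
  by rewrite mulr_ge0 ?sqr_ge0 ?ltW.
have -> : s * (a - s^-1 * b) ^+ 2 = s * a ^+ 2 - 2 * (a * b) + s^-1 * b ^+ 2.
  by field; rewrite gt_eqF.
by lra.
Qed.

(** The assumption on mu gives mu |T| <= K (gamma delta)^(1/2) for
    K = min (C_X, C_{Y*}), trivially so if T = 0. After Young's inequality for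
    gamma^(1/2) |x - u| and delta^(1/2) |q - p|, the factor K is replaced by C_X
    in one square and by C_{Y*} in the other, and both squares turn into Bregman
    distances. *)
Lemma coupling_bregman {R : realType} {X Y : normedModType R}
  (T : clin X Y) (CX CYs gamma delta mu : R) :
  0 < CX -> 0 < CYs ->
  (forall x u : X, CX / 2 * `|x - u| ^+ 2 <= bregman x u) ->
  (forall q p : dual Y, CYs / 2 * `|q - p| ^+ 2 <= bregman q p) ->
  0 < gamma -> 0 < delta -> 0 < mu ->
  (T != 0 -> mu <= Num.sqrt (gamma * delta) * Num.min CX CYs / `|T|) ->
  forall (s : R) (x u : X) (q p : dual Y), 0 < s ->
    `|mu * pairing (T (x - u)) (q - p)|
      <= s * (gamma * bregman x u) + s^-1 * (delta * bregman q p).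
Proof.
move=> CX0 CYs0 bregX bregYs gamma0 delta0 mu0 mu_le s x u q p s0.
set K := Num.min CX CYs in mu_le.
have K0 : 0 <= K by rewrite le_min !ltW.
have muT : mu * opnorm T <= Num.sqrt gamma * Num.sqrt delta * K.
  rewrite -(sqrtrM _ (ltW gamma0)); have [T0|T0] := eqVneq T 0.
    by rewrite -clin_normE T0 normr0 mulr0 mulr_ge0 ?sqrtr_ge0.
  by rewrite -clin_normE -ler_pdivlMr ?normr_gt0 // mu_le.
rewrite normrM gtr0_norm //.
have := bregX x u; have := bregYs q p.
set d := x - u; set r := q - p => Yr Xd.
have step : mu * `|pairing (T d) r| <=
    K * ((Num.sqrt gamma * `|d|) * (Num.sqrt delta * `|r|)).
  apply: le_trans (ler_wpM2l (ltW mu0) (coupling_le_norm T d r)) _.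
  have -> : mu * (opnorm T * `|d| * `|r|) = mu * opnorm T * (`|d| * `|r|) by ring.
  apply: le_trans (ler_wpM2r _ muT) _; first by rewrite mulr_ge0.
  by rewrite le_eqVlt; apply/orP; left; apply/eqP; ring.
apply: le_trans step _.
apply: le_trans (ler_wpM2l K0 (weighted_young s _ _ s0)) _.
rewrite !exprMn (sqr_sqrtr (ltW gamma0)) (sqr_sqrtr (ltW delta0)).
have si0 : 0 < s^-1 by rewrite invr_gt0.
have KX : K * `|d| ^+ 2 <= 2 * bregman x u.
  have : K * `|d| ^+ 2 <= CX * `|d| ^+ 2 by rewrite ler_wpM2r ?sqr_ge0 // ge_min lexx.
  by move: Xd; lra.
have KY : K * `|r| ^+ 2 <= 2 * bregman q p.
  have : K * `|r| ^+ 2 <= CYs * `|r| ^+ 2.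
    by rewrite ler_wpM2r ?sqr_ge0 // ge_min lexx orbT.
  by move: Yr; lra.
have := ler_wpM2l (ltW (mulr_gt0 s0 gamma0)) KX.
have := ler_wpM2l (ltW (mulr_gt0 si0 delta0)) KY.
by lra.
Qed.

Lemma rate_bounds {R : realType} (mu theta : R) :
  0 < mu -> 1 / (1 + mu) <= theta <= 1 ->
  let omega := (1 + theta) / (2 + mu) in
  [/\ 0 < omega, omega < 1, omega <= theta, 1 <= omega * (1 + mu) &
      1 + theta = omega * (2 + mu)].
Proof.
move=> mu0 /andP[theta_ge theta1] omega.
have mu1 : 0 < 1 + mu by lra.
have mu2 : 0 < 2 + mu by lra.
have theta0 : 0 < theta by apply: lt_le_trans theta_ge; rewrite divr_gt0.
move: theta_ge; rewrite ler_pdivrMr // => theta_mu.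
split.
- by rewrite divr_gt0 // addr_gt0.
- by rewrite ltr_pdivrMr //; lra.
- by rewrite ler_pdivrMr //; lra.
- by rewrite /omega mulrAC ler_pdivlMr //; lra.
- by rewrite divfK ?gt_eqF.
Qed.

(** Here e1 = mu <T (x_k - x_{k-1}), p_{k+1} - pbar>. Splitting
      theta e1 = omega c0 + omega (e1 - c0) + (theta - omega) e1
    the two remainders cost omega^2 a0 + d1 and
    (theta - omega) (omega a0 + D1 / omega). The total at a0 is omega theta,
    at most the omega contained in the old energy; at D1 there remains
    1 + mu - (theta / omega - 1), which is 1 / omega exactly by the choice of
    omega. *)
Lemma lyapunov_step {R : realType} (mu theta omega : R)
  (A0 A1 D0 D1 a0 a1 d1 c0 c1 e1 : R) :
  0 < omega -> omega <= theta -> theta <= 1 -> 1 <= omega * (1 + mu) ->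
  1 + theta = omega * (2 + mu) ->
  0 <= A1 -> 0 <= a0 ->
  `|e1 - c0| <= omega * a0 + omega^-1 * d1 ->
  `|e1| <= omega * a0 + omega^-1 * D1 ->
  (1 + mu) * (A1 + D1) + a1 + d1 + (c1 - theta * e1) <= A0 + D0 ->
  A1 + D1 + omega * (a1 + c1) <= omega * (A0 + D0 + omega * (a0 + c0)).
Proof.
move=> omega0 omega_theta theta1 omega_mu thetaE A10 a00.
move=> /ler_normlP[_ ec] /ler_normlP[_ e].
rewrite -(ler_pM2l omega0) => prox.
move: (ler_wpM2l (ltW (mulr_gt0 omega0 omega0)) ec).
have otw : 0 <= omega * (theta - omega).
  by rewrite mulr_ge0 ?(ltW omega0) // subr_ge0.
move: (ler_wpM2l otw e).
have : 0 <= A1 * (omega * (1 + mu) - 1) by rewrite mulr_ge0 ?subr_ge0.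
have : 0 <= omega * omega * a0 * (1 - theta).
  by rewrite !mulr_ge0 ?subr_ge0 ?(ltW omega0).
have -> : omega * (theta - omega) * (omega * a0 + omega^-1 * D1) =
    omega * omega * (theta - omega) * a0 + (theta - omega) * D1.
  by field; rewrite gt_eqF.
have -> : omega * omega * (omega * a0 + omega^-1 * d1) =
    omega * omega * omega * a0 + omega * d1.
  by field; rewrite gt_eqF.
have : theta * D1 = (omega * (2 + mu) - 1) * D1 by rewrite -thetaE; ring.
move: prox; lra.
Qed.

(** * Linear convergence *)

Theorem theorem6 (R : realType) (X Y : completeNormedModType R)
  (reflX : reflexive_space X) (smoothX : smooth_space X) (cvxX : two_convex X)
  (reflYs : reflexive_space (dual Y)) (smoothYs : smooth_space (dual Y))
  (cvxYs : two_convex (dual Y))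
  (T : clin X Y) (f : X -> \bar R) (g : Y -> \bar R)
  (fG : Gamma f) (gG : Gamma g)
  (f_ge0 : forall x, (0 <= f x)%E) (g_ge0 : forall y, (0 <= g y)%E)
  (xbar : X) (pbar : dual Y)
  (sol : saddle_point T f g xbar (- pbar))
  (CX CYs : R) (CX_gt0 : 0 < CX) (CYs_gt0 : 0 < CYs)
  (bregX : forall x u : X, CX / 2 * `|x - u| ^+ 2 <= bregman x u)
  (bregYs : forall ys p : dual Y, CYs / 2 * `|ys - p| ^+ 2 <= bregman ys p)
  (gamma delta : R) (gamma_gt0 : 0 < gamma) (delta_gt0 : 0 < delta)
  (f_strong : forall (x u : X) (xs : dual X), subdiff f x xs ->
     ((pairing (u - x) xs + gamma * bregman u x)%:E <= f u - f x)%E)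
  (g_strong : forall (ys p : dual Y) (y : Y),
     subdiff (fenchel g) ys (bidual_emb y) ->
     ((pairing y (p - ys) + delta * bregman p ys)%:E
       <= fenchel g p - fenchel g ys)%E)
  (mu sigma tau theta : R) (mu_gt0 : 0 < mu)
  (mu_le : T != 0 -> mu <= Num.sqrt (gamma * delta) * Num.min CX CYs / `|T|)
  (sigmaE : sigma = mu / delta) (tauE : tau = mu / gamma)
  (theta_itv : 1 / (1 + mu) <= theta <= 1)
  (x xhat : nat -> X) (p : nat -> dual Y)
  (xhat0 : xhat 0%N = x 0%N)
  (p_step : forall k, resolvent sigma (fenchel g)
     (J (p k) + sigma *: bidual_emb (T (xhat k))) (p k.+1))
  (x_step : forall k, resolvent tau f
     (J (x k) - tau *: adjoint T (p k.+1)) (x k.+1))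
  (xhat_step : forall k, xhat k.+1 = x k.+1 + theta *: (x k.+1 - x k)) :
  let omega := (1 + theta) / (2 + mu) in
  omega < 1 /\
  forall N : nat,
    (1 - omega) * delta * bregman pbar (p N) + gamma * bregman xbar (x N)
    <= omega ^+ N *
       (delta * bregman pbar (p 0%N) + gamma * bregman xbar (x 0%N)).
Proof.
move: (rate_bounds mu theta mu_gt0 theta_itv).
move: ((1 + theta) / (2 + mu)) => omega /=.
move=> [omega0 omega1 omega_theta omega_mu thetaE].
have theta1 : theta <= 1 by case/andP: theta_itv.
have [[fP _ _] [gP _ _]] := (fG, gG).
have gsP := proper_fenchel g g_ge0 gP.
have [fbar gbar] : subdiff f xbar (- adjoint T pbar) /\
    subdiff (fenchel g) pbar (bidual_emb (T xbar)).
  exact/saddle_pointP.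
have f_breg : bregman_convex gamma f by move=> z u zs; exact: f_strong.
(* Every subgradient of the conjugate comes from a point of Y. *)
have g_breg : bregman_convex delta (fenchel g).
  move=> ys q F; have [y ->] := reflexive_predual Y reflYs F.
  exact: g_strong.
have coupling := coupling_bregman T CX CYs gamma delta mu CX_gt0 CYs_gt0 bregX
  bregYs gamma_gt0 delta_gt0 mu_gt0 mu_le.
have breg_ge0 (x1 x2 : X) : 0 <= bregman x1 x2.
  by apply: le_trans (bregX _ _); rewrite mulr_ge0 ?sqr_ge0 // divr_ge0 // ltW.
have bregs_ge0 (q1 q2 : dual Y) : 0 <= bregman q1 q2.
  by apply: le_trans (bregYs _ _); rewrite mulr_ge0 ?sqr_ge0 // divr_ge0 // ltW.
(* As 0.-1 = 0, the convention x_{-1} = x_0 is built into x k.-1. *)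
have xhatE k : xhat k = x k + theta *: (x k - x k.-1).
  by case: k => [|k]; rewrite ?xhat0 ?subrr ?scaler0 ?addr0 // xhat_step.
have pairing_TB y z (q : dual Y) :
    pairing (T (y - z)) q = pairing (T y) q - pairing (T z) q.
  by rewrite linearB pairingBl.
pose A k := gamma * bregman xbar (x k).
pose D k := delta * bregman pbar (p k).
pose a k := gamma * bregman (x k) (x k.-1).
pose c k := mu * pairing (T (x k - x k.-1)) (p k - pbar).
pose V k := A k + D k + omega * (a k + c k).
have V_step k : V k.+1 <= omega * V k.
  pose e1 := mu * pairing (T (x k - x k.-1)) (p k.+1 - pbar).
  pose d1 := delta * bregman (p k.+1) (p k).
  apply: (@lyapunov_step _ mu theta omega _ _ _ _ _ _ d1 _ _ e1) => //.
  - by rewrite mulr_ge0 // ltW.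
  - by rewrite mulr_ge0 // ltW.
  - have := coupling omega (x k) (x k.-1) (p k.+1) (p k) omega0.
    by congr (`|_| <= _); rewrite /e1 /c !pairingBr; ring.
  - have := coupling omega (x k) (x k.-1) pbar (p k.+1) omega0.
    by congr (_ <= _); rewrite -normrN /e1 !pairingBr; congr (`|_|); ring.
  pose t z := pairing (T z) (p k.+1 - pbar).
  have tB y z : t (y - z) = t y - t z by exact: pairing_TB.
  have tZ r z : t (r *: z) = r * t z by rewrite /t /pairing !linearZ.
  have xstep : (1 + mu) * A k.+1 + a k.+1 + mu * (t (x k.+1) - t xbar) <= A k.
    have -> : t (x k.+1) - t xbar = pairing (x k.+1 - xbar)
        (adjoint T (p k.+1) - adjoint T pbar) by rewrite -tB.
    have x_res : resolvent (mu / gamma) f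
        (J (x k) - (mu / gamma) *: adjoint T (p k.+1)) (x k.+1).
      by rewrite -tauE; exact: x_step.
    exact: (resolvent_step _ _ _ _ _ _ _ _ fP f_breg gamma_gt0 mu_gt0 breg_ge0
      x_res fbar).
  have pstep : (1 + mu) * D k.+1 + d1 + mu * (t xbar - t (xhat k)) <= D k.
    have -> : t xbar - t (xhat k) = pairing (p k.+1 - pbar)
        (- bidual_emb (T (xhat k)) - - bidual_emb (T xbar)).
      by rewrite opprK [- bidual_emb _ + _]addrC.
    have p_res : resolvent (mu / delta) (fenchel g)
        (J (p k) - (mu / delta) *: - bidual_emb (T (xhat k))) (p k.+1).
      by rewrite -sigmaE scalerN opprK.
    apply: (resolvent_step _ _ _ _ _ _ _ _ gsP g_breg delta_gt0 mu_gt0 bregs_ge0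
      p_res).
    by rewrite opprK.
  have c1E : c k.+1 = mu * (t (x k.+1) - t (x k)) by rewrite -tB.
  have e1E : e1 = mu * (t (x k) - t (x k.-1)) by rewrite -tB.
  have txhat : t (xhat k) = t (x k) + theta * (t (x k) - t (x k.-1)).
    by rewrite xhatE -[theta *: _]opprK tB -scaleNr tZ tB; ring.
  rewrite c1E e1E; move: xstep pstep; rewrite txhat.
  move: (A k.+1) (D k.+1) (a k.+1) d1 (t _) (t _) (t _) (t _) (A k) (D k).
  clear -mu; move=> *; lra.
have VN N : V N <= omega ^+ N * V 0.
  elim: N => [|N IH]; first by rewrite expr0 mul1r.
  by apply: le_trans (V_step N) _; rewrite exprS -mulrA ler_wpM2l // ltW.
split=> // N.
suff: (1 - omega) * D N + A N <= omega ^+ N * (D 0 + A 0) by rewrite /D mulrA.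
have V0 : V 0 = D 0 + A 0.
  have a0 : a 0 = 0 by rewrite /a /bregman pairingBl !subrr mulr0.
  have c0 : c 0 = 0 by rewrite /c pairing_TB subrr mulr0.
  by rewrite /V c0 a0 addr0 mulr0 addr0 addrC.
rewrite -V0; apply: le_trans (VN N).
have aD : - c N <= a N + D N.
  have := coupling 1 (x N) (x N.-1) pbar (p N) ltr01.
  rewrite invr1 !mul1r => /ler_normlP[_]; congr (_ <= _).
  by rewrite /c !pairingBr -mulrN opprB.
have := ler_wpM2l (ltW omega0) aD; rewrite /V.
by move: (A N) (D N) (a N) (c N); clear -R omega; move=> *; lra.
Qed.
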